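(* Let $N, C \ge 1$ be integers, let $S \in \mathbb R^{N\times N}$, let $\Omega$ be the set of matrices $X=(x_{ki}) \in [0,1]^{C\times N}$ with $\sum_{k=1}^C x_{ki}=1$ for every $i\in\{1,\dots,N\}$, and let $f(X)=\|S-X^\top X\|_F^2$ for $X\in\mathbb R^{C\times N}$. Let $\bar X=(\bar x_{ki})\in\Omega$ be a local minimizer of the problem $\min_{X\in\Omega} f(X)$. In addition, let $\bar V=(\bar v_{ki})\in\mathbb R^{C\times N}$ be a direction such that $\langle\nabla f(\bar X),\bar V\rangle_F=0$ and $\bar V\in T(\bar X;\Omega)$. Then $$\langle\nabla^2 f(\bar X)\bar V,\bar V\rangle_F\ge 0$$ and $$\langle\nabla f(\bar X),W\rangle_F\ge 0\quad\text{for all } W\in T^2(\bar X,\bar V;\Omega),$$ where the Hessian $\nabla^2 f(\bar X)$ maps $V\in\mathbb R^{C\times N}$ to $$\nabla^2 f(\bar X)V=-4V(S-\bar X^\top\bar X)+4\bar X(V^\top\bar X+\bar X^\top V)\in\mathbb R^{C\times N},$$ and the second-order tangent cone to $\Omega$ at $\bar X$ in direction $\bar V$ is given by $$T^2(\bar X,\bar V;\Omega)=\Bigl\{W=(w_{ki})\in\mathbb R^{C\times N}\ \Big|\ \sum_{k=1}^C w_{ki}=0\ \ \forall i;\ \ w_{ki}\ge 0\ \text{if } \bar x_{ki}=0 \text{ and } \bar v_{ki}=0\Bigr\}.$$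
   Context: $\|\cdot\|_F$ is the Frobenius norm on matrices and $\langle A,B\rangle_F=\operatorname{trace}(A^\top B)$ is the corresponding inner product; the gradient $\nabla f$ on $\mathbb R^{C\times N}$ is taken with respect to it, and the Hessian $\nabla^2 f(\bar X)$ is the Fréchet derivative at $\bar X$ of the map $X\mapsto\nabla f(X)$, viewed as a linear operator on $\mathbb R^{C\times N}$. The matrix $S$ is an observed similarity matrix among $N$ items, given by data. A point $\bar X\in\Omega$ is a local minimizer if $f(\bar X)\le f(X)$ for all $X\in\Omega$ sufficiently close to $\bar X$. The (Bouligand-Severi) tangent cone $T(\bar X;\Omega)$ to $\Omega$ at $\bar X\in\Omega$ is the set of $V\in\mathbb R^{C\times N}$ for which there exist points $X^n\in\Omega$ and scalars $\tau_n>0$ ($n=1,2,\dots$) with $\tau_n\downarrow 0$ and $V=\lim_{n\to\infty}\frac{X^n-\bar X}{\tau_n}$. For $\bar X\in\Omega$ and $\bar V\in T(\bar X;\Omega)$, the second-order tangent cone $T^2(\bar X,\bar V;\Omega)$ is the set of $W\in\mathbb R^{C\times N}$ for which there exist points $X^n\in\Omega$ and scalars $\tau_n>0$ ($n=1,2,\dots$) with $\tau_n\downarrow 0$ and $W=\lim_{n\to\infty}\frac{X^n-\bar X-\tau_n\bar V}{\frac12\tau_n^2}$.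
   Formalization: The printed formula for ∇²f(X̄)V is false for non-symmetric S; it is proved as an operator identity only when S is symmetric, while for every S only ⟨∇²f(X̄)V,V⟩ is shown to agree with it. All other claims are proved for arbitrary S. *)

(* Defs.v *)
From HB Require Import structures.
From mathcomp Require Import all_boot all_order all_algebra.
From mathcomp Require Import all_classical all_reals all_analysis.

Set Implicit Arguments.
Unset Strict Implicit.
Unset Printing Implicit Defensive.

Import Order.TTheory GRing.Theory Num.Theory.
Import numFieldNormedType.Exports.
Local Open Scope classical_set_scope.
Local Open Scope ring_scope.

Definition frob_dot (R : realType) (m n : nat) (A B : 'M[R]_(m, n)) : R :=
  \tr (A^T *m B).

Definition frob_norm (R : realType) (m n : nat) (A : 'M[R]_(m, n)) : R :=
  Num.sqrt (frob_dot A A).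

(* The topology used for limits and Frechet derivatives is the one of the
   library's max norm on matrices, which is equivalent to the Frobenius norm. *)

(* Riesz representative of the Frechet derivative ['d f X] for the Frobenius
   inner product; [gradP] shows that it exists. *)
Definition grad (R : realType) (m n : nat) (f : 'M[R]_(m, n) -> R)
    (X : 'M[R]_(m, n)) : 'M[R]_(m, n) :=
  get [set G : 'M[R]_(m, n) | forall V, 'd f X V = frob_dot G V].

Definition hess (R : realType) (m n : nat) (f : 'M[R]_(m, n) -> R)
    (X V : 'M[R]_(m, n)) : 'M[R]_(m, n) :=
  'd (grad f) X V.

Definition local_minimizer (R : realType) (m n : nat) (f : 'M[R]_(m, n) -> R)
    (Om : set 'M[R]_(m, n)) (X : 'M[R]_(m, n)) : Prop :=
  Om X /\ \forall Y \near X, Om Y -> f X <= f Y.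

(* [tau] is positive and decreases (weakly) to 0; asking only for convergence
   to 0 gives the same cones, by extracting a subsequence. *)
Definition tangent_cone (R : realType) (m n : nat) (Om : set 'M[R]_(m, n))
    (X : 'M[R]_(m, n)) : set 'M[R]_(m, n) :=
  [set V | exists (x : nat -> 'M[R]_(m, n)) (tau : nat -> R),
    [/\ forall p, Om (x p),
        forall p, 0 < tau p,
        nonincreasing_seq tau,
        tau @ \oo --> 0
      & (fun p => (tau p)^-1 *: (x p - X)) @ \oo --> V]].

Definition tangent_cone2 (R : realType) (m n : nat) (Om : set 'M[R]_(m, n))
    (X V : 'M[R]_(m, n)) : set 'M[R]_(m, n) :=
  [set W | exists (x : nat -> 'M[R]_(m, n)) (tau : nat -> R),
    [/\ forall p, Om (x p),
        forall p, 0 < tau p,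
        nonincreasing_seq tau,
        tau @ \oo --> 0
      & (fun p => (2^-1 * tau p ^+ 2)^-1 *: (x p - X - tau p *: V))
          @ \oo --> W]].

Definition Omega (R : realType) (C N : nat) : set 'M[R]_(C, N) :=
  [set X | (forall k i, 0 <= X k i <= 1) /\ forall i, \sum_(k < C) X k i = 1].

Definition objective (R : realType) (C N : nat) (S : 'M[R]_N)
    (X : 'M[R]_(C, N)) : R :=
  frob_norm (S - X^T *m X) ^+ 2.

(* The Frechet derivative of [grad (objective S)] at [X] is
     V |-> - 2 V (S + S^T - 2 X^T X) + 4 X (V^T X + X^T V);
   it equals the map below when [S] is symmetric. For a general [S] the two
   maps may differ, but they have the same quadratic form, because
   <V S, V> = <V S^T, V>. *)
Definition hess_formula (R : realType) (C N : nat) (S : 'M[R]_N)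
    (X V : 'M[R]_(C, N)) : 'M[R]_(C, N) :=
  - (4 *: (V *m (S - X^T *m X))) + 4 *: (X *m (V^T *m X + X^T *m V)).

Lemma frob_dotE (R : realType) (m n : nat) (A B : 'M[R]_(m, n)) :
  frob_dot A B = \sum_i \sum_j A i j * B i j.
Proof.
rewrite /frob_dot /mxtrace exchange_big /=; apply: eq_bigr => j _.
by rewrite mxE; apply: eq_bigr => i _; rewrite mxE.
Qed.

Lemma gradP (R : realType) (m n : nat) (f : 'M[R]_(m, n) -> R)
    (X V : 'M[R]_(m, n)) : 'd f X V = frob_dot (grad f X) V.
Proof.
suff [G GP] : [set G : 'M[R]_(m, n) | forall V, 'd f X V = frob_dot G V] !=set0.
  exact: (@getI _ [set G | forall V, 'd f X V = frob_dot G V] G GP).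
exists (\matrix_(i, j) 'd f X (delta_mx i j)) => {}V.
rewrite frob_dotE {1}(matrix_sum_delta V) linear_sum; apply: eq_bigr => i _.
rewrite linear_sum; apply: eq_bigr => j _.
by rewrite linearZ /= mxE mulrC.
Qed.

Lemma objectiveE (R : realType) (C N : nat) (S : 'M[R]_N) (X : 'M[R]_(C, N)) :
  objective S X = \sum_i \sum_j (S i j - \sum_k X k i * X k j) ^+ 2.
Proof.
rewrite /objective /frob_norm sqr_sqrtr frob_dotE.
  apply: eq_bigr => i _; apply: eq_bigr => j _; rewrite -expr2 !mxE.
  by congr ((_ - _) ^+ 2); apply: eq_bigr => k _; rewrite mxE.
by apply: sumr_ge0 => i _; apply: sumr_ge0 => j _; rewrite -expr2 sqr_ge0.
Qed.

Lemma differentiable_objective (R : realType) (C N : nat) (S : 'M[R]_N)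
    (X : 'M[R]_(C, N)) : differentiable (objective S : 'M[R]_(C, N) -> R) X.
Proof.
have -> : (objective S : 'M[R]_(C, N) -> R) =
    \sum_i \sum_j (fun Y : 'M[R]_(C, N) =>
      S i j - (\sum_k (fun Y : 'M[R]_(C, N) => Y k i * Y k j)) Y) ^+ 2.
  apply/funext => Y; rewrite objectiveE fct_sumE; apply: eq_bigr => i _.
  rewrite fct_sumE; apply: eq_bigr => j _.
  by rewrite !exprfctE fct_sumE.
apply: differentiable_sum => i; apply: differentiable_sum => j.
apply: differentiableX; apply: differentiableB; first exact: differentiable_cst.
apply: differentiable_sum => k.
by apply: differentiableM; exact: differentiable_coord.
Qed.

(* Main.v *)
Require Import Defs.
From HB Require Import structures.
From mathcomp Require Import all_boot all_order all_algebra.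
From mathcomp Require Import all_classical all_reals all_analysis.
From mathcomp Require Import ring lra.
Import Order.TTheory GRing.Theory Num.Theory.
Import numFieldNormedType.Exports.
Local Open Scope classical_set_scope.
Local Open Scope ring_scope.

(**
Along a line, [objective S] is a polynomial of degree 4, which gives its
gradient and the quadratic form of its Hessian. Since [Omega] is a polytope,
[Xbar + t Vbar + t^2/2 W] lies in [Omega] for all small [t > 0] as soon as
[Vbar] and [W] satisfy the linear constraints that are active; this yields the
second-order cone, and with [W = 0] the sign of the Hessian term. Finally
convexity gives [<grad f Xbar, Y - Xbar> >= 0] for [Y] in [Omega]; at
[Y = Xbar + t Vbar + t^2/2 W] the left-hand side is [t^2/2 <grad f Xbar, W>].
*)

(** * Bilinearity and adjoints for the Frobenius product *)

Section FrobeniusProduct.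
Set Implicit Arguments.
Unset Strict Implicit.
Context {R : realType}.

Lemma frob_dotC m n (A B : 'M[R]_(m, n)) : frob_dot A B = frob_dot B A.
Proof. by rewrite /frob_dot -mxtrace_tr trmx_mul trmxK. Qed.

Lemma frob_dotDr m n (A B D : 'M[R]_(m, n)) :
  frob_dot A (B + D) = frob_dot A B + frob_dot A D.
Proof. by rewrite /frob_dot mulmxDr mxtraceD. Qed.

Lemma frob_dotZr m n a (A B : 'M[R]_(m, n)) :
  frob_dot A (a *: B) = a * frob_dot A B.
Proof. by rewrite /frob_dot -scalemxAr mxtraceZ. Qed.

Lemma frob_dotNr m n (A B : 'M[R]_(m, n)) : frob_dot A (- B) = - frob_dot A B.
Proof. by rewrite -scaleN1r frob_dotZr mulN1r. Qed.

Lemma frob_dotDl m n (A B D : 'M[R]_(m, n)) :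
  frob_dot (B + D) A = frob_dot B A + frob_dot D A.
Proof. by rewrite !(frob_dotC _ A) frob_dotDr. Qed.

Lemma frob_dotZl m n a (A B : 'M[R]_(m, n)) :
  frob_dot (a *: B) A = a * frob_dot B A.
Proof. by rewrite !(frob_dotC _ A) frob_dotZr. Qed.

Lemma frob_dotNl m n (A B : 'M[R]_(m, n)) : frob_dot (- B) A = - frob_dot B A.
Proof. by rewrite !(frob_dotC _ A) frob_dotNr. Qed.

Lemma frob_dot_tr m n (A B : 'M[R]_(m, n)) :
  frob_dot A^T B^T = frob_dot A B.
Proof. by rewrite frob_dotC /frob_dot trmxK mxtrace_mulC. Qed.

Lemma frob_dot_mulmxr m n p (A : 'M[R]_(m, n)) (X : 'M[R]_(p, m)) V :
  frob_dot A (X^T *m V) = frob_dot (X *m A) V.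
Proof. by rewrite /frob_dot trmx_mul mulmxA. Qed.

Lemma frob_dot_mulmxl m n p (A : 'M[R]_(m, n)) (X : 'M[R]_(p, n)) V :
  frob_dot A (V^T *m X) = frob_dot (X *m A^T) V.
Proof. by rewrite -frob_dot_tr trmx_mul trmxK frob_dot_mulmxr. Qed.

(** Testing against matrix units recovers the entries. This is the uniqueness of the Riesz
    representative, by which [grad] is identified. *)
Lemma frob_dot_inj m n (A B : 'M[R]_(m, n)) :
  (forall V, frob_dot A V = frob_dot B V) -> A = B.
Proof.
move=> AB; apply/matrixP => i j.
have E D : frob_dot D (delta_mx i j) = D i j.
  rewrite frob_dotE (bigD1 i)//= (bigD1 j)//= !mxE !eqxx mulr1.
  rewrite big1 ?addr0; last first.
    by move=> l /negPf lj; rewrite mxE lj andbF mulr0.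
  rewrite big1 ?addr0// => l /negPf li.
  by rewrite big1// => q _; rewrite mxE li mulr0.
by rewrite -!E AB.
Qed.

Lemma frob_normE m n (A : 'M[R]_(m, n)) : frob_norm A ^+ 2 = frob_dot A A.
Proof.
rewrite /frob_norm sqr_sqrtr// frob_dotE.
by apply: sumr_ge0 => i _; apply: sumr_ge0 => j _; rewrite -expr2 sqr_ge0.
Qed.

End FrobeniusProduct.

(** * Limits and derivatives read off polynomial expansions *)

Section PolynomialAlongLines.
Set Implicit Arguments.
Unset Strict Implicit.
Context {R : realType}.

Lemma cvg_cubic (W : normedModType R) (a b c d : W) :
  a + t *: b + t ^+ 2 *: c + t ^+ 3 *: d @[t --> (0 : R)] --> a.
Proof.
have -> : a = a + (0 : R) *: b + (0 : R) ^+ 2 *: c + (0 : R) ^+ 3 *: d.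
  by rewrite !expr0n/= !scale0r !addr0.
have cX k (w : W) : t ^+ k *: w @[t --> (0 : R)] --> (0 : R) ^+ k *: w.
  by apply: cvgZr_tmp; exact: exprn_continuous.
apply: cvgD; last exact: cX.
apply: cvgD; last exact: cX.
apply: cvgD; first by rewrite !expr0n/= !scale0r !addr0; exact: cvg_cst.
by have := cX 1%N b; rewrite expr1; exact.
Qed.

(** For [h != 0] the difference quotient is exactly the cubic, which tends to [a]. The target [W] is
    general so as to serve the scalar objective and its matrix-valued gradient. *)
Lemma derive_polynomial_line (V W : normedModType R) (F : V -> W) (x v : V)
    (a b c d : W) :
  (forall h : R, F (h *: v + x) =
    F x + h *: (a + h *: b + h ^+ 2 *: c + h ^+ 3 *: d)) ->
  'D_v F x = a.
Proof.
move=> FE; apply: cvg_lim => //.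
have : a + h *: b + h ^+ 2 *: c + h ^+ 3 *: d @[h --> (0 : R)^'] --> a.
  by apply: cvg_within_filter; exact: cvg_cubic.
apply: cvg_trans.
apply: near_eq_cvg; near=> h.
have h0 : h != 0 by near: h; exact: nbhs_dnbhs_neq.
by rewrite /= FE [F x + _]addrC addrK scalerA mulVf// scale1r.
Unshelve. all: by end_near. Qed.

Lemma cubic_right_ge0 (a b c d : R) :
  (\forall t \near (0 : R)^'+, 0 <= a + t * b + t ^+ 2 * c + t ^+ 3 * d) ->
  0 <= a.
Proof.
exact/cvgr_to_ge/cvg_at_right_filter/(@cvg_cubic R^o).
Qed.

End PolynomialAlongLines.

(** * Gradient and Hessian of the objective *)

Section Objective.
Set Implicit Arguments.
Unset Strict Implicit.
Context {R : realType} {C N : nat} (S : 'M[R]_N).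
Implicit Types X V : 'M[R]_(C, N).

(** The derivative of the Gram map [X |-> X^T *m X] in direction [V]. *)
Let dgram X V := V^T *m X + X^T *m V.

Let dgram_tr X V : (dgram X V)^T = dgram X V.
Proof. by rewrite /dgram linearD/= !trmx_mul !trmxK addrC. Qed.

Let gram_line X V h :
  (h *: V + X)^T *m (h *: V + X) =
  X^T *m X + h *: dgram X V + h ^+ 2 *: (V^T *m V).
Proof.
have -> : (h *: V + X)^T = h *: V^T + X^T by rewrite linearD linearZ.
rewrite /dgram mulmxDl !mulmxDr -!scalemxAl -!scalemxAr.
rewrite scalerA; apply/matrixP => i j; rewrite !mxE; ring.
Qed.

(** Both [S] and [S^T] occur because [S] is arbitrary; for symmetric [S] this is
    [- 4 X (S - X^T X)]. *)
Definition grad_objective X : 'M[R]_(C, N) :=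
  - 2 *: (X *m (S + S^T - 2 *: (X^T *m X))).

Let dot_grad_objective X V :
  frob_dot (grad_objective X) V = - 2 * frob_dot (S - X^T *m X) (dgram X V).
Proof.
rewrite /dgram frob_dotDr frob_dot_mulmxl frob_dot_mulmxr -frob_dotDl -mulmxDr.
rewrite linearB/= trmx_mul trmxK frob_dotZl; congr (_ * frob_dot (_ *m _) _).
by rewrite addrACA [S^T + S]addrC -opprD -mulr2n scaler_nat.
Qed.

(** The right-hand side is twice the coefficient of [h ^+ 2] in the expansion of the objective along
    [V]. Since [dgram X V] is symmetric, its two summands contribute equally to its squared norm. *)
Lemma dot_hess_formula X V :
  frob_dot (hess_formula S X V) V =
  2 * (frob_dot (V^T *m X + X^T *m V) (V^T *m X + X^T *m V)
       - 2 * frob_dot (S - X^T *m X) (V^T *m V)).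
Proof.
rewrite [frob_dot (S - _) _]frob_dot_mulmxr -/(dgram X V).
have -> : frob_dot (dgram X V) (dgram X V) = 2 * frob_dot (X *m dgram X V) V.
  rewrite {2}/dgram frob_dotDr frob_dot_mulmxl frob_dot_mulmxr dgram_tr.
  by rewrite mulr2n mulrDl mul1r.
rewrite /hess_formula frob_dotDl frob_dotNl !frob_dotZl; ring.
Qed.

(** With [G = S - X^T X], [L = dgram X V] and [Q = V^T V], this expands the squared norm of
    [G - h L - h^2 Q]. The increment is factored by [h], ready for difference quotients. *)
Lemma objective_line X V h :
  objective S (h *: V + X) = objective S X +
    h *: (frob_dot (grad_objective X) V
      + h *: (2^-1 * frob_dot (hess_formula S X V) V)
      + h ^+ 2 *: (2 * frob_dot (V^T *m X + X^T *m V) (V^T *m V))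
      + h ^+ 3 *: frob_dot (V^T *m V) (V^T *m V)).
Proof.
rewrite dot_hess_formula dot_grad_objective /objective !frob_normE gram_line.
rewrite -/(dgram X V).
have -> : S - (X^T *m X + h *: dgram X V + h ^+ 2 *: (V^T *m V)) =
    (S - X^T *m X) - h *: dgram X V - h ^+ 2 *: (V^T *m V).
  by rewrite !opprD !addrA.
move: (S - _) (dgram X V) (V^T *m V) => G L Q.
rewrite !(frob_dotDl, frob_dotDr, frob_dotNl, frob_dotNr, frob_dotZl,
  frob_dotZr).
rewrite (frob_dotC L G) (frob_dotC Q G) (frob_dotC Q L) /GRing.scale/=.
by field.
Qed.

Lemma grad_objectiveE : grad (objective S) = grad_objective.
Proof.
apply/funext => X; apply: frob_dot_inj => V.
rewrite -gradP -deriveE; last exact: differentiable_objective.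
exact: derive_polynomial_line (objective_line X V).
Qed.

Lemma differentiable_grad_objective X :
  differentiable (grad (objective S) : 'M[R]_(C, N) -> 'M[R]_(C, N)) X.
Proof.
rewrite grad_objectiveE.
(* Expands the gradient over matrix units, with entries built from coordinate maps, so that the
   differentiation rules for sums and products apply. *)
have -> : grad_objective = \sum_k \sum_i (fun Y : 'M[R]_(C, N) =>
    (- 2 *: \sum_j ((fun Y : 'M[R]_(C, N) => Y k j) *
       (cst ((S + S^T) j i) -
        2 *: \sum_l ((fun Y : 'M[R]_(C, N) => Y l j) *
                    (fun Y : 'M[R]_(C, N) => Y l i))))) Y
     *: (delta_mx k i : 'M[R]_(C, N))).
  apply/funext => Y; rewrite {1}(matrix_sum_delta (grad_objective Y)).
  rewrite fct_sumE; apply: eq_bigr => k _; rewrite fct_sumE.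
  apply: eq_bigr => i _; congr (_ *: _).
  rewrite /grad_objective 2!mxE; congr (_ * _); rewrite fct_sumE.
  apply: eq_bigr => j _; rewrite mxE.
  rewrite [in RHS]/GRing.mul/= [X in _ = _ * (_ + X)]/=; congr (_ * (_ + _)).
  rewrite !mxE -[RHS]/(- (2 * _)) fct_sumE; congr (- (2 * _)).
  by apply: eq_bigr => l _; rewrite mxE.
apply: differentiable_sum => k; apply: differentiable_sum => i.
apply: differentiableZl; apply: differentiableZ.
apply: differentiable_sum => j; apply: differentiableM.
  exact: differentiable_coord.
apply: differentiableB; first exact: differentiable_cst.
apply: differentiableZ; apply: differentiable_sum => l.
by apply: differentiableM; exact: differentiable_coord.
Qed.

Lemma hess_objectiveE X V :
  hess (objective S) X V =
  4 *: (X *m (V^T *m X + X^T *m V)) - 2 *: (V *m (S + S^T - 2 *: (X^T *m X))).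
Proof.
rewrite /hess -deriveE; last exact: differentiable_grad_objective.
rewrite grad_objectiveE.
(* These are the coefficients of [h ^+ 2] and [h ^+ 3] in the gradient along the line; the last one
   is 0 because the gradient is cubic. *)
apply: (@derive_polynomial_line _ _ _ _ _ _ _
  (4 *: (X *m (V^T *m V) + V *m (V^T *m X + X^T *m V)))
  (4 *: (V *m (V^T *m V))) 0) => h.
rewrite /grad_objective gram_line -/(dgram X V).
move: (S + S^T) (X^T *m X) (dgram X V) (V^T *m V) => B G L Q.
rewrite !(mulmxDl, mulmxDr, mulmxN, scalerDr, scalerN, =^~ scalemxAl,
  =^~ scalemxAr, scaler0, addr0) !scalerA.
apply/matrixP => k i; rewrite !mxE; ring.
Qed.

Lemma hess_objective_sym X V :
  S^T = S -> hess (objective S) X V = hess_formula S X V.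
Proof.
move=> Ssym; rewrite hess_objectiveE /hess_formula Ssym.
rewrite !(mulmxDr, mulmxN, scalerDr, scalerN, =^~ scalemxAr).
apply/matrixP => k i; rewrite !mxE; ring.
Qed.

Lemma dot_hess_objective X V :
  frob_dot (hess (objective S) X V) V = frob_dot (hess_formula S X V) V.
Proof.
(* Both sides equal [frob_dot S (V^T *m V)]. *)
have VS : frob_dot (V *m S^T) V = frob_dot (V *m S) V.
  by rewrite -frob_dot_mulmxl -frob_dot_mulmxr.
rewrite hess_objectiveE /hess_formula.
rewrite !(mulmxDr, mulmxN, scalerDr, scalerN, =^~ scalemxAr).
rewrite !(frob_dotDl, frob_dotNl, frob_dotZl) VS; ring.
Qed.

End Objective.

(** * The product of simplices and its tangent cones *)

Section Simplices.
Set Implicit Arguments.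
Unset Strict Implicit.
Context {R : realType} {C N : nat}.
Implicit Types X V W Y : 'M[R]_(C, N).

(** An entry is at most its column sum 1 when the rest of the column is nonnegative. Membership thus
    reduces to signs and column sums. *)
Lemma Omega_ge0 X :
  (forall k i, 0 <= X k i) -> (forall i, \sum_k X k i = 1) -> Omega X.
Proof.
move=> X0 X1; split=> // k i; rewrite X0/= -(X1 i) (bigD1 k)//= lerDl.
by apply: sumr_ge0 => l _; exact: X0.
Qed.

Lemma Omega_convex X Y (t : R) :
  Omega X -> Omega Y -> 0 <= t <= 1 -> Omega (t *: (Y - X) + X).
Proof.
move=> [X01 X1] [Y01 Y1] /andP[t0 t1]; apply: Omega_ge0 => [k i|i].
  rewrite !mxE.
  have -> : t * (Y k i - X k i) + X k i = t * Y k i + (1 - t) * X k i by ring.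
  have [/andP[X0 _] /andP[Y0 _]] := (X01 k i, Y01 k i).
  by rewrite addr_ge0// mulr_ge0// subr_ge0.
under eq_bigr do rewrite !mxE.
by rewrite big_split/= -mulr_sumr sumrB X1 Y1 subrr mulr0 add0r.
Qed.

Lemma cvg_entry (F : nat -> 'M[R]_(C, N)) V k i :
  F @ \oo --> V -> F p k i @[p --> \oo] --> V k i.
Proof.
move=> FV; apply: (cvg_comp F (fun M : 'M[R]_(C, N) => M k i) FV).
exact: (@coord_continuous R C N k i V).
Qed.

Lemma cvg_col_sum (F : nat -> 'M[R]_(C, N)) V i (c : R) :
  F @ \oo --> V -> (forall p, \sum_k F p k i = c) -> \sum_k V k i = c.
Proof.
move=> FV Fc.
have : (\sum_k F p k i) @[p --> \oo] --> \sum_k V k i.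
  apply: cvg_big => [|k _]; first exact: add_continuous.
  exact: cvg_entry.
under eq_fun do rewrite Fc.
by move/cvg_lim => <- //; rewrite lim_cst.
Qed.

Lemma cvg_entry_ge0 (F : nat -> 'M[R]_(C, N)) V k i :
  F @ \oo --> V -> (forall p, 0 <= F p k i) -> 0 <= V k i.
Proof.
by move=> /(@cvg_entry _ _ k i)/cvgr_to_ge FV F0; apply: FV; exact: nearW.
Qed.

(** Each difference quotient already satisfies these linear conditions, and they are closed under
    limits. *)
Lemma tangent_cone_Omega X V : Omega X -> tangent_cone (@Omega R C N) X V ->
  (forall i, \sum_k V k i = 0) /\ (forall k i, X k i = 0 -> 0 <= V k i).
Proof.
move=> [_ X1] [x [tau [xO tau0 _ _ xV]]]; split=> [i|k i Xki0].
  apply: (cvg_col_sum xV) => p; have [_ x1] := xO p.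
  under eq_bigr do rewrite !mxE.
  by rewrite -mulr_sumr sumrB x1 X1 subrr mulr0.
apply: (cvg_entry_ge0 xV) => p; have [x01 _] := xO p.
rewrite !mxE Xki0 subr0 mulr_ge0 ?invr_ge0 ?(ltW (tau0 p))//.
by have /andP[] := x01 k i.
Qed.

(* As Omega is polyhedral, the vectors V and W of its cones are realized by
   points lying exactly on the parabola, without remainder. *)
Lemma near_Omega_parabola X V W : Omega X ->
  (forall i, \sum_k V k i = 0) -> (forall k i, X k i = 0 -> 0 <= V k i) ->
  (forall i, \sum_k W k i = 0) ->
  (forall k i, X k i = 0 -> V k i = 0 -> 0 <= W k i) ->
  \forall t \near (0 : R)^'+, Omega (X + t *: V + (2^-1 * t ^+ 2) *: W).
Proof.
move=> [X01 X1] V0 XV W0 XVW.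
have Xge0 k i : 0 <= X k i by have /andP[] := X01 k i.
suff : \forall t \near (0 : R)^'+, forall k i,
    0 <= X k i + t * V k i + (2^-1 * t ^+ 2) * W k i.
  apply: filterS => t tP; apply: Omega_ge0 => [k i|i].
    by rewrite !mxE.
  under eq_bigr do rewrite !mxE.
  by rewrite !big_split/= -!mulr_sumr X1 V0 W0 !mulr0 !addr0.
apply: filter_forall => k; apply: filter_forall => i.
have pos_near (a b c : R) : 0 < a ->
    \forall t \near (0 : R)^'+, 0 <= a + t * b + t ^+ 2 * c.
  move=> a0; have := cvg_at_right_filter (@cvg_cubic R R^o a b c 0).
  move=> /cvgr_ge/(_ 0 a0); apply: filterS => t.
  by rewrite scaler0 addr0.
(* The first nonzero coefficient among those of [X], [V], [W] decides the sign for small [t]: a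
   positive one dominates the later terms, and if [X] and [V] vanish only [W] is left. *)
have [Xki|Xki|Xki] := ltgtP 0 (X k i); last 2 first.
- by rewrite ltNge Xge0 in Xki.
- have [Vki|Vki|/esym Vki] := ltgtP 0 (V k i).
  + near=> t.
    have t0 : 0 < t by near: t; exact: nbhs_right_gt.
    have -> : X k i + t * V k i + 2^-1 * t ^+ 2 * W k i =
      t * (V k i + t * (2^-1 * W k i) + t ^+ 2 * 0) by rewrite -Xki; ring.
    by rewrite mulr_ge0 ?(ltW t0)//; near: t; exact: pos_near.
  + by have := XV k i (esym Xki); rewrite leNgt Vki.
  + near=> t; rewrite -Xki Vki mulr0 !add0r mulr_ge0//.
      by rewrite mulr_ge0 ?invr_ge0// sqr_ge0.
    exact: XVW.
apply: filterS (pos_near _ (V k i) (2^-1 * W k i) Xki) => t.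
by rewrite mulrCA mulrA.
Unshelve. all: by end_near. Qed.

(** One inclusion passes to the limit: where [X] and [V] vanish, the quotient is a positive multiple
    of an entry of a point of [Omega]. The other takes points on the parabola. *)
Lemma tangent_cone2_Omega X V : Omega X -> tangent_cone (@Omega R C N) X V ->
  tangent_cone2 (@Omega R C N) X V =
    [set W | (forall i, \sum_k W k i = 0) /\
             (forall k i, X k i = 0 -> V k i = 0 -> 0 <= W k i)].
Proof.
move=> XO /(tangent_cone_Omega XO)[V0 XV]; have [_ X1] := XO.
apply/seteqP; split=> W /= [].
  move=> x [tau [xO tau0 _ _ xW]]; split=> [i|k i Xki0 Vki0].
    apply: (cvg_col_sum xW) => p; have [_ x1] := xO p.
    under eq_bigr do rewrite !mxE.
    by rewrite -mulr_sumr !sumrB -mulr_sumr x1 X1 V0 mulr0 subr0 subrr mulr0.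
  apply: (cvg_entry_ge0 xW) => p; have [x01 _] := xO p.
  rewrite !mxE Xki0 Vki0 mulr0 !subr0 mulr_ge0//; last first.
    by have /andP[] := x01 k i.
  by rewrite invr_ge0 mulr_ge0 ?invr_ge0// sqr_ge0.
move=> W0 XVW; have := near_Omega_parabola XO V0 XV W0 XVW.
move=> [e /= e0 eO].
(* Since [harmonic p] is at most 1, with equality at [p = 0], the factor [e / 2] keeps every [tau p]
   strictly below the radius [e]. *)
pose tau p : R := e / 2 * harmonic p.
have tau0 p : 0 < tau p by rewrite mulr_gt0 ?divr_gt0// harmonic_gt0.
exists (fun p => X + tau p *: V + (2^-1 * tau p ^+ 2) *: W), tau.
split=> //.
- move=> p; apply: eO => //=; rewrite sub0r normrN gtr0_norm//.
  have : (p.+1%:R : R)^-1 <= 1 by rewrite invf_le1 ?ler1n.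
  rewrite /tau /harmonic/=; move: (_^-1) => q; nra.
- move=> p q pq; rewrite ler_pM2l ?divr_gt0// lef_pV2 ?posrE//.
  by rewrite ler_nat.
- rewrite -(mulr0 (e / 2)); apply: cvgMl_tmp; exact: cvg_harmonic.
(* On the parabola the second-order quotient is constantly [W]. *)
- rewrite (_ : (fun _ => _) = cst W); first exact: cvg_cst.
  apply/funext => p.
  have -> : X + tau p *: V + (2^-1 * tau p ^+ 2) *: W - X - tau p *: V =
      (2^-1 * tau p ^+ 2) *: W.
    by apply/matrixP => k i; rewrite !mxE; ring.
  by rewrite scalerA mulVf ?scale1r// mulf_neq0//
    ?invr_neq0 ?expf_neq0 ?lt0r_neq0.
Qed.

End Simplices.

(** * First- and second-order necessary conditions *)

Section LocalMinimizer.
Set Implicit Arguments.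
Unset Strict Implicit.
Context {R : realType} {C N : nat}.
Implicit Types X V W Y : 'M[R]_(C, N).

Lemma local_minimizer_line (f : 'M[R]_(C, N) -> R) X V :
  local_minimizer f (@Omega R C N) X ->
  (\forall t \near (0 : R)^'+, Omega (t *: V + X)) ->
  \forall t \near (0 : R)^'+, f X <= f (t *: V + X).
Proof.
move=> [_ Xmin]; have line : t *: V + X @[t --> (0 : R)^'+] --> X.
  apply: cvg_at_right_filter; rewrite -[X in _ --> X]add0r -(scale0r V).
  by apply: cvgD; [exact: cvgZr_tmp|exact: cvg_cst].
by move=> VO; apply: filterS2 VO (line _ Xmin) => t VO /(_ VO).
Qed.

(** The segment from [X] to [Y] is feasible; dividing the increase of the objective by [t > 0] and
    letting [t] tend to 0 leaves the directional derivative. *)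
Lemma local_minimizer_grad S X Y :
  local_minimizer (objective S) (@Omega R C N) X -> Omega Y ->
  0 <= frob_dot (grad (objective S) X) (Y - X).
Proof.
move=> Xmin YO; have [XO _] := Xmin; rewrite grad_objectiveE.
apply: cubic_right_ge0.
have : \forall t \near (0 : R)^'+, Omega (t *: (Y - X) + X).
  near=> t; apply: Omega_convex => //.
  by apply/andP; split; near: t; [exact: nbhs_right_ge|exact: nbhs_right_ltW].
move=> /(local_minimizer_line Xmin) fle; near=> t.
have t0 : 0 < t by near: t; exact: nbhs_right_gt.
have : objective S X <= objective S (t *: (Y - X) + X) by near: t.
rewrite objective_line lerDl pmulr_rge0//; exact.
Unshelve. all: by end_near. Qed.

(** Criticality removes the linear term, so division by [t ^+ 2] leaves half the Hessian form as the
    constant term. *)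
Lemma local_minimizer_hess S X V :
  local_minimizer (objective S) (@Omega R C N) X ->
  frob_dot (grad (objective S) X) V = 0 ->
  tangent_cone (@Omega R C N) X V ->
  0 <= frob_dot (hess (objective S) X V) V.
Proof.
move=> Xmin crit Vtan; have [XO _] := Xmin; rewrite dot_hess_objective.
have [V0 XV] := tangent_cone_Omega XO Vtan.
rewrite -(pmulr_rge0 _ (_ : 0 < 2^-1 :> R)) ?invr_gt0//.
have : \forall t \near (0 : R)^'+, Omega (t *: V + X).
  have := @near_Omega_parabola _ _ _ X V 0 XO V0 XV.
  case=> [i|k i _ _|e e0 eO]; first by rewrite big1// => k; rewrite mxE.
    by rewrite mxE.
  exists e => // t te t0.
  by have := eO t te t0; rewrite scaler0 addr0 addrC.
move=> /(local_minimizer_line Xmin) fle.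
(* After division by [t ^+ 2] the quartic is only quadratic, hence the cubic coefficient 0. *)
apply: (@cubic_right_ge0 _ _ _ _ 0); near=> t.
have t0 : 0 < t by near: t; exact: nbhs_right_gt.
have : objective S X <= objective S (t *: V + X) by near: t.
rewrite objective_line -grad_objectiveE crit lerDl pmulr_rge0// add0r.
rewrite /GRing.scale/=; set a := 2^-1 * _; set b := 2 * _.
set c := frob_dot _ _.
have -> : t * a + t ^+ 2 * b + t ^+ 3 * c =
  t * (a + t * b + t ^+ 2 * c + t ^+ 3 * 0) by ring.
by rewrite pmulr_rge0//; exact.
Unshelve. all: by end_near. Qed.

Lemma local_minimizer_grad2 S X V W :
  local_minimizer (objective S) (@Omega R C N) X ->
  frob_dot (grad (objective S) X) V = 0 ->
  tangent_cone (@Omega R C N) X V -> tangent_cone2 (@Omega R C N) X V W ->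
  0 <= frob_dot (grad (objective S) X) W.
Proof.
move=> Xmin crit Vtan; have [XO _] := Xmin.
rewrite tangent_cone2_Omega// => -[W0 XVW].
have [V0 XV] := tangent_cone_Omega XO Vtan.
have near_YO := near_Omega_parabola XO V0 XV W0 XVW.
(* A single feasible [t] is enough: the linear term vanishes by criticality, and the positive factor
   [2^-1 * t ^+ 2] cancels. *)
suff [t /= [t0 YO]] : exists t : R,
    0 < t /\ Omega (X + t *: V + (2^-1 * t ^+ 2) *: W).
  have := local_minimizer_grad Xmin YO.
  rewrite -[X + _ + _]addrA [X + _]addrC addrK frob_dotDr !frob_dotZr.
  by rewrite crit mulr0 add0r pmulr_rge0// mulr_gt0 ?invr_gt0// exprn_gt0.
near (0 : R)^'+ => t; exists t; split; near: t => //.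
exact: nbhs_right_gt.
Unshelve. all: by end_near. Qed.

End LocalMinimizer.

(** Differentiability of the gradient is part of the conclusion so that [hess], defined through
    ['d], is a genuine Fréchet derivative at [Xbar]. *)
Theorem theorem4p1 (R : realType) (N C : nat) (N_ge1 : (1 <= N)%N)
    (C_ge1 : (1 <= C)%N) (S : 'M[R]_N) (Xbar : 'M[R]_(C, N))
    (Xbar_min : local_minimizer (objective S) (@Omega R C N) Xbar)
    (Vbar : 'M[R]_(C, N))
    (Vbar_crit : frob_dot (grad (objective S) Xbar) Vbar = 0)
    (Vbar_tan : tangent_cone (@Omega R C N) Xbar Vbar) :
  0 <= frob_dot (hess (objective S) Xbar Vbar) Vbar /\
  (forall W : 'M[R]_(C, N), tangent_cone2 (@Omega R C N) Xbar Vbar W ->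
     0 <= frob_dot (grad (objective S) Xbar) W) /\
  differentiable (grad (objective S) : 'M[R]_(C, N) -> 'M[R]_(C, N)) Xbar /\
  (S^T = S -> forall V : 'M[R]_(C, N),
     hess (objective S) Xbar V = hess_formula S Xbar V) /\
  (forall V : 'M[R]_(C, N),
     frob_dot (hess (objective S) Xbar V) V =
     frob_dot (hess_formula S Xbar V) V) /\
  tangent_cone2 (@Omega R C N) Xbar Vbar =
    [set W : 'M[R]_(C, N) |
      (forall i, \sum_(k < C) W k i = 0) /\
      (forall k i, Xbar k i = 0 -> Vbar k i = 0 -> 0 <= W k i)].

Proof.
have [XO _] := Xbar_min.
split; first exact: local_minimizer_hess.
split; first by move=> W; exact: local_minimizer_grad2.
split; first exact: differentiable_grad_objective.
split; first by move=> Ssym V; exact: hess_objective_sym.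
split; first by move=> V; exact: dot_hess_objective.
exact: tangent_cone2_Omega.
Qed.
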